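(* Consider the H3 lattice equation $$p\,(u\,\widetilde u+\widehat u\,\widehat{\widetilde u})-q\,(u\,\widehat u+\widetilde u\,\widehat{\widetilde u})+\delta(p^2-q^2)=0$$ with the parametrization $$\frac{r^2c^2}{c^2-a^2}=p^2,\qquad \frac{r^2c^2}{c^2-b^2}=q^2,\qquad \alpha^2=-\frac{a-c}{a+c},\qquad \beta^2=-\frac{b-c}{b+c}.$$ Then $$u_{n,m}=A\alpha^n\beta^m c^2\left(1+\frac{ab}{c(bn+am)+2ab}\right)+B\alpha^{-n}\beta^{-m}c^{-2}\left(1-\frac{ab}{c(bn+am)+2ab}\right),\qquad AB=-\tfrac14 r\delta,$$ is a (rational) solution of H3. It is the solution $u=A\alpha^n\beta^m\,\dfrac{f(n,m,1)}{f(n,m,0)}+B\alpha^{-n}\beta^{-m}\,\dfrac{f(n,m,-1)}{f(n,m,0)}$ obtained from the $2\times 2$ Casoratian $$f(n,m,l)=\big|\psi(n,m,l),\psi(n,m,l+1)\big|_{k_1=0},\qquad \psi(n,m,l)=\Big(\psi_1(n,m,l),\tfrac{1}{2!}\partial_{k_1}^2\psi_1(n,m,l)\Big)^T,$$ $$\psi_1(n,m,l)=(a+k_1)^n(b+k_1)^m(c+k_1)^{2+l}+(a-k_1)^n(b-k_1)^m(c-k_1)^{2+l}.$$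
   Context: The function $u=u_{n,m}$ lives on the $(n,m)$ lattice, with shifts $\widetilde u=u_{n+1,m}$, $\widehat u=u_{n,m+1}$, $\widehat{\widetilde u}=u_{n+1,m+1}$. Here $p$ and $q$ are the lattice parameters associated with the $n$ and $m$ directions respectively, $\delta$ is an arbitrary constant, $a,b,c,r,\alpha,\beta$ are parameters related to $p,q$ by the stated parametrization, and $A,B$ are constants. The variable $l$ is an auxiliary lattice direction, and $|\cdot,\cdot|$ denotes the determinant of the matrix with the given columns.
   Formalization: The squared relations leave the signs of p, q, α, β free, and H3 fails for mismatched signs; the formal version adds pα(a+c)=rc and qβ(b+c)=rc, and assumes c≠0, c²≠a², c²≠b², no poles, and a,b≠0 for the Casoratian formula. *)

(* Defs.v *)
From mathcomp Require Import all_boot all_order all_algebra.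
From mathcomp Require Import boolp classical_sets topology normedtype derive.

Set Implicit Arguments.
Unset Strict Implicit.
Unset Printing Implicit Defensive.

Import GRing.Theory Num.Theory numFieldNormedType.Exports.
Local Open Scope ring_scope.

Section H3.
Variable K : numFieldType.

(* Quad equation at the elementary square with lower-left vertex (n, m). *)
Definition H3_at (p q delta : K) (u : int -> int -> K) (n m : int) : Prop :=
  p * (u n m * u (n + 1) m + u n (m + 1) * u (n + 1) (m + 1))
  - q * (u n m * u n (m + 1) + u (n + 1) m * u (n + 1) (m + 1))
  + delta * (p ^+ 2 - q ^+ 2) = 0.

Variables a b c : K.

(* The integer power [x ^ n] is used throughout: the lattice is Z x Z. *)
Definition psi1 (n m l : int) (k1 : K) : K :=
  (a + k1) ^ n * (b + k1) ^ m * (c + k1) ^ (2 + l)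
  + (a - k1) ^ n * (b - k1) ^ m * (c - k1) ^ (2 + l).

(* [derive1n 2] is the analytic second derivative, here in the variable k1. *)
Definition psi (n m l : int) (k1 : K) : 'cV[K]_2 :=
  \col_(i < 2)
    if i == 0 then psi1 n m l k1
    else (2`!)%:R^-1 * derive1n 2 (psi1 n m l) k1.

Definition casoratian (n m l : int) (k1 : K) : K :=
  \det (row_mx (psi n m l k1) (psi n m (l + 1) k1) : 'M[K]_2).

Definition f (n m l : int) : K := casoratian n m l 0.

Definition den (n m : int) : K :=
  c * (b * n%:~R + a * m%:~R) + 2 * a * b.

(* Meaningful where [den n m] is nonzero; elsewhere u has a pole. *)
Definition u_rat (alpha beta A B : K) (n m : int) : K :=
  A * alpha ^ n * beta ^ m * c ^+ 2 * (1 + a * b / den n m)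
  + B * alpha ^ (- n) * beta ^ (- m) * c ^- 2 * (1 - a * b / den n m).

End H3.

(* Main.v *)
(* Write u = X (1 + t) + Y (1 - t) with X ~ alpha^n beta^m, Y ~ alpha^-n beta^-m
   and t = ab / den.  After p alpha = r c / (a + c), p / alpha = r c / (c - a)
   and their analogues for q, the coefficients of X^2, Y^2 and X Y in the
   lattice equation become rational identities in a, b, c and den.

   psi1 is g(k) + g(-k) with g(k) = (a+k)^n (b+k)^m (c+k)^(2+l), so f only
   involves g(0) and g''(0), which are read off the logarithmic derivative of g;
   the second order terms cancel and
   f(n,m,l) = 4 g(0)^2 (den + l a b) / (a b c). *)

Require Import Defs.
From mathcomp Require Import all_boot all_order all_algebra.
From mathcomp Require Import boolp classical_sets functions topology.
From mathcomp Require Import normedtype derive.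
From mathcomp Require Import ring.

Set Implicit Arguments.
Unset Strict Implicit.
Unset Printing Implicit Defensive.

Import GRing.Theory Num.Theory numFieldNormedType.Exports.
Local Open Scope ring_scope.

(** * The lattice equation as a rational identity *)

(** [X] and [Y] absorb the powers at the base vertex, and [D] stands for [den] there. A step in n
    multiplies by [alpha] and adds [c * b] to [D], a step in m multiplies by [beta] and adds
    [c * a], so one identity covers all elementary squares. *)
Lemma H3_two_exponentials (K : numFieldType)
    (p q r delta a b c alpha beta X Y D : K) :
  a + c != 0 -> b + c != 0 -> c - a != 0 -> c - b != 0 ->
  alpha != 0 -> beta != 0 ->
  alpha ^+ 2 = (c - a) / (a + c) -> beta ^+ 2 = (c - b) / (b + c) ->
  p * alpha * (a + c) = r * c -> q * beta * (b + c) = r * c ->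
  X * Y = - (4^-1 * r * delta) ->
  D != 0 -> D + c * b != 0 -> D + c * a != 0 -> D + c * a + c * b != 0 ->
  let u x d := X * x * (1 + a * b / d) + Y / x * (1 - a * b / d) in
  let u0 := u 1 D in
  let u1 := u alpha (D + c * b) in
  let u2 := u beta (D + c * a) in
  let u12 := u (alpha * beta) (D + c * a + c * b) in
  p * (u0 * u1 + u2 * u12) - q * (u0 * u2 + u1 * u12)
  + delta * (p ^+ 2 - q ^+ 2) = 0.
Proof.
move=> ac bc ca cb al0 be0 hal hbe hp hq hXY D0 D1 D2 D12 u u0 u1 u2 u12.
have pE : p * alpha = r * c / (a + c) by rewrite -hp; field.
have qE : q * beta = r * c / (b + c) by rewrite -hq; field.
(* Knowing both [p * alpha] and [p / alpha] as rational functions avoids square roots, since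
   [p ^+ 2] is their product. *)
have pV : p / alpha = r * c / (c - a).
  have -> : p / alpha = p * alpha / alpha ^+ 2 by field.
  by rewrite pE hal; field; rewrite ac ca.
have qV : q / beta = r * c / (c - b).
  have -> : q / beta = q * beta / beta ^+ 2 by field.
  by rewrite qE hbe; field; rewrite bc cb.
pose t1 := a * b / (D + c * b); pose t2 := a * b / (D + c * a).
pose t := a * b / D; pose t3 := a * b / (D + c * a + c * b).
pose W (x y : K) : K := (1 + x) * (1 - y).
pose P1 := p * alpha; pose P2 := p / alpha.
pose Q1 := q * beta; pose Q2 := q / beta.
pose a2 := alpha ^+ 2; pose b2 := beta ^+ 2.
(* In this grouping only the products [P1], [P2], [Q1], [Q2] and the squares [a2], [b2] occur. The
   coefficients of [X ^+ 2] and [Y ^+ 2] vanish separately; the [X * Y] term cancels the one in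
   [delta]. *)
transitivity (X ^+ 2 * (P1 * ((1 + t) * (1 + t1) + b2 * (1 + t2) * (1 + t3))
   - Q1 * ((1 + t) * (1 + t2) + a2 * (1 + t1) * (1 + t3)))
 + Y ^+ 2 * (P2 * ((1 - t) * (1 - t1) + (1 - t2) * (1 - t3) / b2)
   - Q2 * ((1 - t) * (1 - t2) + (1 - t1) * (1 - t3) / a2))
 + (X * Y) * (P2 * (W t t1 + W t2 t3) + P1 * (W t1 t + W t3 t2)
    - Q2 * (W t t2 + W t1 t3) - Q1 * (W t2 t + W t3 t1))
 + delta * (P1 * P2 - Q1 * Q2)).
  rewrite /u12 /u2 /u1 /u0 /u -/t -/t1 -/t2 -/t3.
  rewrite /W /P1 /P2 /Q1 /Q2 /a2 /b2.
  by field; rewrite al0 be0.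
rewrite hXY /P1 /P2 /Q1 /Q2 /a2 /b2 /W pE qE pV qV hal hbe /t /t1 /t2 /t3.
by field; rewrite ac bc ca cb D0 D1 D2 D12.
Qed.

(** * Differentiation of the waves at zero *)

(** The logarithmic form is uniform in the sign of [z] and turns products of powers into sums. *)
Lemma is_derive_exprz (K : numFieldType) (g : K -> K) (x v dg : K) (z : int) :
  g x != 0 -> is_derive x v g dg ->
  is_derive x v (fun y => g y ^ z) (g x ^ z * (z%:~R * dg / g x)).
Proof.
move=> gx0 Dg; have Dn (n : nat) :
    is_derive x v (fun y => g y ^+ n) (g x ^+ n * (n%:R * dg / g x)).
  have D := is_deriveX n Dg; rewrite exprfctE in D.
  apply: (is_derive_eq D); rewrite /GRing.scale /=.
  (* The power rule uses the truncated predecessor of [n], so [n = 0] is treated apart. *)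
  by case: n {D} => [|n] /=; [rewrite !mul0r mulr0 | rewrite exprS; field].
case: z => n; first exact: Dn.
have gn0 : g x ^+ n.+1 != 0 by rewrite expf_neq0.
have [Dgn dgn] := Dn n.+1.
have DV := @derivableV K K (fun y => g y ^+ n.+1) x v gn0 Dgn.
have dV := @deriveV K K (fun y => g y ^+ n.+1) x v gn0 Dgn.
rewrite [fun y => _](_ : _ = (fun y => (g y ^+ n.+1)^-1)) //.
apply: (DeriveDef DV); rewrite dV dgn /GRing.scale /= NegzE -exprnN.
rewrite mulrNz -[n.+1%:~R]/(n.+1%:R).
by field; rewrite gx0 gn0.
Qed.

Lemma is_derive_affine (K : numFieldType) (a e x : K) :
  is_derive x 1 (fun k : K => a + e * k) e.
Proof.
have D : is_derive x 1 (cst a + e \*: (@id K)) (0 + e *: (1 : K)).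
  exact: is_deriveD.
by apply: (is_derive_eq D); rewrite add0r /GRing.scale /= mulr1.
Qed.

(* With [e = 1] and [e = -1] these are the two summands of [psi1], and
   [wave_log] is their logarithmic derivative in [k]. *)
Definition wave (K : numFieldType) (a b c e : K) (n m l : int) (k : K) : K :=
  (a + e * k) ^ n * (b + e * k) ^ m * (c + e * k) ^ l.

Definition wave_log (K : numFieldType) (a b c e : K) (n m l : int) (k : K) : K :=
  n%:~R * e / (a + e * k) + m%:~R * e / (b + e * k) + l%:~R * e / (c + e * k).

Section Wave.
Variables (K : numFieldType) (a b c e : K) (n m l : int).
Hypotheses (ha : a != 0) (hb : b != 0) (hc : c != 0).

Lemma is_derive_wave (k : K) :
  a + e * k != 0 -> b + e * k != 0 -> c + e * k != 0 ->
  is_derive k 1 (wave a b c e n m l)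
    (wave a b c e n m l k * wave_log a b c e n m l k).
Proof.
move=> ka kb kc.
have Da := @is_derive_exprz K (fun y => a + e * y) k 1 e n ka
  (is_derive_affine a e k).
have Db := @is_derive_exprz K (fun y => b + e * y) k 1 e m kb
  (is_derive_affine b e k).
have Dc := @is_derive_exprz K (fun y => c + e * y) k 1 e l kc
  (is_derive_affine c e k).
have D := is_deriveM (is_deriveM Da Db) Dc; rewrite !mulrfctE in D.
apply: (is_derive_eq D); rewrite /GRing.scale /wave /wave_log /=.
ring.
Qed.

Lemma wave0 : wave a b c e n m l 0 = a ^ n * b ^ m * c ^ l.
Proof. by rewrite /wave mulr0 !addr0. Qed.

Lemma wave_log0 :
  wave_log a b c e n m l 0 = e * (n%:~R / a + m%:~R / b + l%:~R / c).
Proof. by rewrite /wave_log mulr0 !addr0; ring. Qed.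

Lemma is_derive_wave_log0 : e ^+ 2 = 1 ->
  is_derive (0 : K) (1 : K) (wave_log a b c e n m l)
    (- (n%:~R / a ^+ 2 + m%:~R / b ^+ 2 + l%:~R / c ^+ 2)).
Proof.
move=> e2.
have T (d : K) (z : int) : d != 0 ->
    is_derive (0 : K) (1 : K) (fun k : K => z%:~R * e / (d + e * k))
      (- (z%:~R / d ^+ 2)).
  move=> d0; have d0' : d + e * 0 != 0 by rewrite mulr0 addr0.
  have D := @is_derive_exprz K (fun y => d + e * y) 0 1 e (-1) d0'
    (is_derive_affine d e 0).
  have DZ := is_deriveZ (z%:~R * e) D.
  apply: (is_derive_eq DZ).
  rewrite mulr0 addr0 /GRing.scale /= exprN1.
  have -> : (-1)%:~R = -1 :> K by [].
  transitivity (- (z%:~R * e ^+ 2 / d ^+ 2)); first by field.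
  by rewrite e2 mulr1.
have D := is_deriveD (is_deriveD (T a n ha) (T b m hb)) (T c l hc).
rewrite !addrfctE in D.
by apply: (is_derive_eq D); ring.
Qed.

(** With L the logarithmic derivative of g, g'' = g (L^2 + L'). At 0 the sign [e] enters only
    through its square, so both summands of [psi1] contribute equally. *)
Lemma is_derive_wave_second0 : e ^+ 2 = 1 ->
  is_derive (0 : K) (1 : K)
    (fun k => wave a b c e n m l k * wave_log a b c e n m l k)
    (a ^ n * b ^ m * c ^ l *
     ((n%:~R / a + m%:~R / b + l%:~R / c) ^+ 2
      - (n%:~R / a ^+ 2 + m%:~R / b ^+ 2 + l%:~R / c ^+ 2))).
Proof.
move=> e2.
have nz d : d != 0 -> d + e * 0 != 0 by rewrite mulr0 addr0.
have D := is_deriveM (is_derive_wave (nz _ ha) (nz _ hb) (nz _ hc))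
  (is_derive_wave_log0 e2).
rewrite mulrfctE in D; apply: (is_derive_eq D).
rewrite /GRing.scale /= wave0 wave_log0.
set s := _ + _ + l%:~R / c.
transitivity (a ^ n * b ^ m * c ^ l *
  (e ^+ 2 * s ^+ 2 - (n%:~R / a ^+ 2 + m%:~R / b ^+ 2 + l%:~R / c ^+ 2))).
  ring.
by rewrite e2 mul1r.
Qed.

End Wave.

(** A second derivative at 0 needs the first one on a neighbourhood, where the bases of the integer
    powers must stay nonzero. *)
Lemma near0_affine_neq0 (K : numFieldType) (a e : K) :
  a != 0 -> \forall k \near (0 : K), a + e * k != 0.
Proof.
move=> a0; have [/derivable1_diffP/differentiable_continuous cf _] :=
  is_derive_affine a e 0.
by apply: (cvgr_neq0 _ cf); rewrite mulr0 addr0.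
Qed.

Section SecondDerivative.
Variables (K : numFieldType) (a b c : K) (n m l : int).
Hypotheses (ha : a != 0) (hb : b != 0) (hc : c != 0).

Lemma psi1_wave :
  psi1 a b c n m l = wave a b c 1 n m (2 + l) + wave a b c (-1) n m (2 + l).
Proof. by apply/funext => k; rewrite addrfctE /psi1 /wave mul1r mulN1r. Qed.

Lemma psi1_second0 :
  derive1n 2 (psi1 a b c n m l) 0 =
  2 * (a ^ n * b ^ m * c ^ (2 + l) *
     ((n%:~R / a + m%:~R / b + (2 + l)%:~R / c) ^+ 2
      - (n%:~R / a ^+ 2 + m%:~R / b ^+ 2 + (2 + l)%:~R / c ^+ 2))).
Proof.
rewrite psi1_wave /derive1n /= derive1E.
pose W e k := wave a b c e n m (2 + l) k * wave_log a b c e n m (2 + l) k.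
have Wnear (e : K) : \forall k \near (0 : K),
    is_derive k (1 : K) (wave a b c e n m (2 + l)) (W e k).
  near=> k; apply: is_derive_wave; near: k; exact: near0_affine_neq0.
(* The closed form of the first derivative is available only near 0, which suffices because a
   derivative at 0 depends on the germ. *)
have -> : 'D_1 (wave a b c 1 n m (2 + l)
      + wave a b c (-1) n m (2 + l))^`()%classic 0 = 'D_1 (W 1 + W (-1)) (0 : K).
  apply: near_eq_derive; near=> k.
  rewrite derive1E.
  have D1 : is_derive k (1 : K) (wave a b c 1 n m (2 + l)) (W 1 k).
    by near: k; exact: Wnear.
  have D2 : is_derive k (1 : K) (wave a b c (-1) n m (2 + l)) (W (-1) k).
    by near: k; exact: Wnear.
  by have [_ ->] := is_deriveD D1 D2.
have s1 : (1 : K) ^+ 2 = 1 by rewrite expr1n.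
have s2 : (-1 : K) ^+ 2 = 1 by rewrite sqrrN expr1n.
have [_ ->] := is_deriveD (is_derive_wave_second0 n m (2 + l) ha hb hc s1)
  (is_derive_wave_second0 n m (2 + l) ha hb hc s2).
ring.
Unshelve. all: by end_near. Qed.

Lemma psi1_0 : psi1 a b c n m l 0 = 2 * (a ^ n * b ^ m * c ^ (2 + l)).
Proof. by rewrite /psi1 !subr0 !addr0; ring. Qed.

End SecondDerivative.

(** * Evaluation of the Casoratian *)

Lemma det_mx2 (R : comNzRingType) (M : 'M[R]_2) :
  \det M = M 0 0 * M 1 1 - M 0 1 * M 1 0.
Proof.
have l01 : lift 0 0 = 1 :> 'I_2 by exact: val_inj.
have l10 : lift 1 0 = 0 :> 'I_2 by exact: val_inj.
rewrite (expand_det_row _ 0) !big_ord_recl big_ord0 /cofactor !det_mx11 !mxE /=.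
by rewrite !l01 !l10; ring.
Qed.

Lemma casoratianE (K : numFieldType) (a b c : K) (n m l : int) (k : K) :
  casoratian a b c n m l k =
  2^-1 * (psi1 a b c n m l k * derive1n 2 (psi1 a b c n m (l + 1)) k
          - psi1 a b c n m (l + 1) k * derive1n 2 (psi1 a b c n m l) k).
Proof.
have E0 (u v : 'cV[K]_2) i : row_mx u v i 0 = u i 0.
  by rewrite -(row_mxEl u v i 0); congr (row_mx u v i _); exact: val_inj.
have E1 (u v : 'cV[K]_2) i : row_mx u v i 1 = v i 0.
  by rewrite -(row_mxEr u v i 0); congr (row_mx u v i _); exact: val_inj.
have P0 l' : psi a b c n m l' k 0 0 = psi1 a b c n m l' k by rewrite mxE.
have P1 l' : psi a b c n m l' k 1 0 = 2^-1 * derive1n 2 (psi1 a b c n m l') k.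
  by rewrite mxE.
rewrite /casoratian det_mx2 !E0 !E1.
move: (P0 l) (P1 l) (P0 (l + 1)) (P1 (l + 1)).
move: (psi a b c n m l k) (psi a b c n m (l + 1) k) => u v -> -> -> ->.
(* [ring] would compare the derivatives up to unfolding. *)
move: (derive1n 2 _ k) (derive1n 2 _ k).
move: (psi1 _ _ _ _ _ _ k) (psi1 _ _ _ _ _ _ k).
move=> x1 x0 d1 d0; ring.
Qed.

(** Put S = n/a + m/b + (2+l)/c. Raising l by one multiplies g(0) by c, adds 1/c to S and 1/c^2 to
    the sum of inverse squares. Since (S + 1/c)^2 - S^2 - 1/c^2 = 2S/c, the determinant is 4 g(0)^2
    S. *)
Lemma f_eq (K : numFieldType) (a b c : K) (n m l : int) :
  a != 0 -> b != 0 -> c != 0 ->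
  f a b c n m l = 4 * (a ^ n * b ^ m * c ^ (2 + l)) ^+ 2
    * (den a b c n m + l%:~R * (a * b)) / (a * b * c).
Proof.
move=> ha hb hc; rewrite /f casoratianE !psi1_0 !psi1_second0 //.
rewrite [2 + (l + 1)]addrA (expfzDr (2 + l) 1 hc) expr1z.
rewrite (intrD K (2 + l) 1) (intrD K 2 l) -[1%:~R]/(1 : K) -[2%:~R]/(2 : K) /den.
set g := a ^ n * b ^ m * c ^ (2 + l).
rewrite !(mulrA (a ^ n * b ^ m)) -/g.
by field; rewrite ha hb hc.
Qed.

(* The squared relations only give p * alpha * (a + c) = +- r * c and likewise
   for q; hpalpha and hqbeta select the square roots for which
   A * B = - r * delta / 4 is the right normalization. *)
Theorem mainTheorem3 (K : numFieldType)
    (p q r delta a b c alpha beta A B : K)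
    (hc : c != 0) (hca : c ^+ 2 != a ^+ 2) (hcb : c ^+ 2 != b ^+ 2)
    (hp : r ^+ 2 * c ^+ 2 / (c ^+ 2 - a ^+ 2) = p ^+ 2)
    (hq : r ^+ 2 * c ^+ 2 / (c ^+ 2 - b ^+ 2) = q ^+ 2)
    (halpha : alpha ^+ 2 = - ((a - c) / (a + c)))
    (hbeta : beta ^+ 2 = - ((b - c) / (b + c)))
    (hpalpha : p * alpha * (a + c) = r * c)
    (hqbeta : q * beta * (b + c) = r * c)
    (hAB : A * B = - (4^-1 * r * delta)) :
  (forall n m : int,
      den a b c n m != 0 -> den a b c (n + 1) m != 0 ->
      den a b c n (m + 1) != 0 -> den a b c (n + 1) (m + 1) != 0 ->
      H3_at p q delta (u_rat a b c alpha beta A B) n m)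
  /\
  (a != 0 -> b != 0 -> forall n m : int, den a b c n m != 0 ->
      f a b c n m 0 != 0 /\
      u_rat a b c alpha beta A B n m =
        A * alpha ^ n * beta ^ m
          * (f a b c n m 1 / f a b c n m 0)
        + B * alpha ^ (- n) * beta ^ (- m)
          * (f a b c n m (-1) / f a b c n m 0)).
Proof.
split.
  have sq_neq (x : K) : c ^+ 2 != x ^+ 2 -> x + c != 0 /\ c - x != 0.
    rewrite -subr_eq0 subr_sqr mulf_eq0 negb_or addrC => /andP[-> ?].
    by rewrite addrC.
  have root_neq0 (x y : K) :
      x + c != 0 -> c - x != 0 -> y ^+ 2 = - ((x - c) / (x + c)) ->
      y != 0 /\ y ^+ 2 = (c - x) / (x + c).
    move=> xc cx; rewrite -mulNr opprB => yE; split=> //.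
    have : y ^+ 2 != 0 by rewrite yE mulf_neq0 ?invr_neq0.
    by rewrite expf_eq0.
  have [ac ca] := sq_neq _ hca; have [bc cb] := sq_neq _ hcb.
  have [al0 alE] := root_neq0 _ _ ac ca halpha.
  have [be0 beE] := root_neq0 _ _ bc cb hbeta.
  move=> n m.
  have denS1 : den a b c (n + 1) m = den a b c n m + c * b.
    by rewrite /den intrD; ring.
  have denS2 : den a b c n (m + 1) = den a b c n m + c * a.
    by rewrite /den intrD; ring.
  have denS12 : den a b c (n + 1) (m + 1) = den a b c n m + c * a + c * b.
    by rewrite /den !intrD; ring.
  rewrite denS1 denS2 denS12 => D0 D1 D2 D12.
  have aln : alpha ^ n != 0 by rewrite expfz_neq0.
  have bem : beta ^ m != 0 by rewrite expfz_neq0.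
  pose X := A * alpha ^ n * beta ^ m * c ^+ 2.
  pose Y := B * alpha ^ (- n) * beta ^ (- m) * c ^- 2.
  have XY : X * Y = - (4^-1 * r * delta).
    by rewrite -hAB /X /Y -!invr_expz; field; rewrite aln bem hc.
  have := H3_two_exponentials ac bc ca cb al0 be0 alE beE hpalpha hqbeta XY
    D0 D1 D2 D12.
  rewrite /H3_at; congr (_ = 0).
  (* With [i] and [j] in {0, 1} this gives the four vertices in terms of the same [X] and [Y]. *)
  have uE i j : u_rat a b c alpha beta A B (n + i) (m + j) =
      X * (alpha ^ i * beta ^ j) * (1 + a * b / den a b c (n + i) (m + j))
      + Y / (alpha ^ i * beta ^ j) * (1 - a * b / den a b c (n + i) (m + j)).
    rewrite /u_rat /X /Y -!invr_expz !expfzDr //.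
    by rewrite !invfM; ring.
  have := uE 0 0; rewrite !addr0 !expr0z !mulr1 divr1 => ->.
  have := uE 1 0; rewrite !addr0 expr0z expr1z mulr1 denS1 => ->.
  have := uE 0 1; rewrite !addr0 expr0z expr1z mul1r denS2 => ->.
  by rewrite uE !expr1z denS12.
move=> ha hb n m D0.
have g0 : a ^ n * b ^ m != 0 by rewrite mulf_neq0 ?expfz_neq0.
have c2 (l : int) : c ^ (2 + l) = c ^+ 2 * c ^ l by rewrite expfzDr.
(* In the ratio of f at l to f at 0 all common factors cancel, leaving c^(2l) (1 + l a b / den),
   used for l = 1 and l = -1. *)
rewrite /u_rat !f_eq // (c2 0) (c2 1) expr0z (expr1z c).
rewrite mul0r addr0 mul1r mulN1r mulr1.
set D := den a b c n m in D0 *; set g := a ^ n * b ^ m in g0 *.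
split.
  have h4 : 4 * (g * c ^+ 2) ^+ 2 != 0.
    by rewrite mulf_neq0 ?pnatr_eq0 // expf_neq0 //
      mulf_neq0 // expf_neq0.
  by rewrite (mulf_neq0 (mulf_neq0 h4 D0)) // invr_neq0 // !mulf_neq0.
by congr (_ + _); rewrite -mulrA; congr (_ * _); field; rewrite ha hb hc g0 D0.
Qed.
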